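(* Let $b \geq 2$ and $k \geq 1$ be integers. For $n \geq 1$ put $c_k^b(n) := \frac{b^{kn}-1}{b^n-1} = 1 + b^n + b^{2n} + \cdots + b^{(k-1)n}$, and let $$\mathcal{S}_k^b := \{0\} \cup \{ a \cdot c_k^b(n) \ : \ n \geq 1,\ b^{n-1} \leq a < b^n \}$$ be the set of base-$b$ $k$'th powers. Define \begin{align*} A_k &= \gcd(\mathcal{S}_k^b), \\ B_k &= \gcd(c_k^b(1), c_k^b(2), c_k^b(3), \ldots), \\ C_k &= \gcd(c_k^b(1), c_k^b(2), \ldots, c_k^b(k)), \\ D_k &= \gcd(c_k^b(1), c_k^b(k)), \\ E_k &= \gcd\!\left(\frac{b^k-1}{b-1},\, k\right). \end{align*} Then $A_k = B_k = C_k = D_k = E_k$.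
   Context: A natural number $N$ is called a base-$b$ $k$'th power if its canonical base-$b$ representation (without leading zeros) consists of $k$ consecutive identical blocks; $0$ is counted as one. Equivalently, $N=0$ or $N = a\cdot c_k^b(n)$ with $n \geq 1$ and $b^{n-1} \leq a < b^n$; this is the set $\mathcal{S}_k^b$ of the claim. The gcd of an infinite set of integers means the greatest common divisor of all its elements. *)

(* Defs.v *)
From mathcomp Require Import all_boot.
From mathcomp Require Import boolp classical_sets.

Set Implicit Arguments.
Unset Strict Implicit.
Unset Printing Implicit Defensive.

Local Open Scope classical_set_scope.

Definition common_divisor (S : set nat) (d : nat) : Prop :=
  forall x, S x -> d %| x.

(* Greatest for divisibility, the convention of [gcdn].  As soon as [S] has a
   nonzero element this is also the numerically greatest common divisor
   (see [set_gcd_max]); otherwise it is 0. *)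
Definition is_set_gcd (S : set nat) (d : nat) : Prop :=
  common_divisor S d /\ forall e, common_divisor S e -> e %| d.

(* The default value 0 of [xget] is never used, see [set_gcdP]. *)
Definition set_gcd (S : set nat) : nat := xget 0 [set d | is_set_gcd S d].

Lemma set_gcdP (S : set nat) : is_set_gcd S (set_gcd S).
Proof.
suff [d Sd] : exists d, is_set_gcd S d.
  exact: (@xgetPex _ 0 [set d | is_set_gcd S d] (ex_intro _ d Sd)).
case: (pselect (exists2 m, S m & m != 0)) => [[m Sm m0]|S0]; last first.
  exists 0; split=> [x Sx|e _]; last exact: dvdn0.
  by case: (eqVneq x 0) => [->//|x0]; case: S0; exists x.
exists (\big[lcmn/1]_(i < m.+1 | `[< common_divisor S i >]) i).
split=> [x Sx|e Se].
  by apply/dvdn_biglcmP => i /asboolP; apply.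
have em : e < m.+1 by rewrite ltnS dvdn_leq ?lt0n //; apply: Se.
by apply: (@biglcmn_sup _ (Ordinal em)) => //; apply/asboolP.
Qed.

Lemma set_gcd_max (S : set nat) (m e : nat) :
  S m -> m != 0 -> common_divisor S e -> e <= set_gcd S.
Proof.
move=> Sm m0 Se; have [dS maxd] := set_gcdP S.
apply: dvdn_leq; last exact: maxd.
by apply: (dvdn_gt0 _ (dS m Sm)); rewrite lt0n.
Qed.

Definition c (b k n : nat) : nat := (b ^ (k * n) - 1) %/ (b ^ n - 1).

Lemma cE (b k n : nat) : 2 <= b -> 1 <= n ->
  c b k n = \sum_(i < k) b ^ (i * n).
Proof.
move=> b2 n1; rewrite /c mulnC expnM !subn1 predn_exp mulKn.
  by apply: eq_bigr => i _; rewrite -expnM mulnC.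
by rewrite -subn1 subn_gt0 -(expn0 b) ltn_exp2l.
Qed.

Definition kth_powers (b k : nat) : set nat :=
  [set 0] `|` [set N | exists n a,
    [/\ 1 <= n, b ^ (n - 1) <= a < b ^ n & N = a * c b k n]].

(* Main.v *)
Require Import Defs.
From mathcomp Require Import all_boot.
From mathcomp Require Import boolp classical_sets.

Local Open Scope classical_set_scope.

(** All five numbers divide one another cyclically once [E] is known to divide
    every [c b k n].  Let [p ^ e] be the [p]-part of [E].  If [p] does not
    divide [b ^ n - 1], then [p ^ e] is coprime to it and divides
    [c b k n * (b ^ n - 1) = b ^ (k * n) - 1], a multiple of [b ^ k - 1].
    Otherwise [b ^ n = 1 %[mod p]], and [p ^ e %| k] makes the geometric sum
    [c b k n] with ratio [b ^ n] and [k] terms divisible by [p ^ e]. *)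

Lemma dvdn_pfactor_geometric_sum (p e q m : nat) :
  q = 1 %[mod p] -> p ^ e %| m -> p ^ e %| \sum_(i < m) q ^ i.
Proof.
elim: e q m => [|e IHe] q m q1; first by rewrite dvd1n.
have qX1 i : q ^ i = 1 %[mod p] by rewrite -modnXm q1 modnXm exp1n.
rewrite expnSr => /dvdnP[t ->]; rewrite mulnA.
rewrite -(big_mkord xpredT (fun i => q ^ i)) big_nat_mul big_mkord.
(* Once the terms are grouped into blocks of [p], induction with ratio [q ^ p] gives the factor
   [p ^ e]; a single block is a sum of [p] terms congruent to 1 and gives one more [p]. *)
suff -> : \sum_(i < t * p ^ e) \sum_(i * p <= j < i.+1 * p) q ^ j
        = (\sum_(i < t * p ^ e) (q ^ p) ^ i) * \sum_(j < p) q ^ j.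
  apply: dvdn_mul; first by apply: IHe (qX1 p) (dvdn_mull _ _).
  rewrite /dvdn -modn_summ.
  under eq_bigr => i _ do rewrite qX1.
  by rewrite modn_summ sum1_card card_ord modnn.
rewrite big_distrl /=; apply: eq_bigr => i _.
rewrite mulSn addnC -[X in \sum_(X <= _ < _) _]add0n big_addn.
rewrite [_ * p + p]addnC addnK big_mkord big_distrr /=.
by apply: eq_bigr => j _; rewrite addnC expnD mulnC -expnM [p * i]mulnC mulnC.
Qed.

Section KthPowers.

Variables b k : nat.
Hypotheses (b_gt1 : 2 <= b) (k_gt0 : 1 <= k).

Lemma mul_c_sub1 n : 1 <= n -> c b k n * (b ^ n - 1) = b ^ (k * n) - 1.
Proof.
move=> n1; rewrite cE // [k * n]mulnC expnM !subn1 [RHS]predn_exp mulnC.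
by congr (_ * _); apply: eq_bigr => i _; rewrite -expnM mulnC.
Qed.

Lemma c1E : c b k 1 = (b ^ k - 1) %/ (b - 1).
Proof. by rewrite /c muln1 expn1. Qed.

Lemma c1_dvd_sub1 n : c b k 1 %| b ^ (k * n) - 1.
Proof.
apply: (@dvdn_trans (b ^ k - 1)).
  by rewrite -[k in b ^ k]muln1 -mul_c_sub1 // dvdn_mulr.
by rewrite expnM !subn1 [X in _ %| X]predn_exp dvdn_mulr.
Qed.

(** Modulo [c b k 1], a divisor of [b ^ k - 1], each of the [k] terms [b ^ (i * k)] of [c b k k] is
    1, so [c b k k] reduces to [k]. *)
Lemma gcdn_c1_ck : gcdn (c b k 1) (c b k k) = gcdn (c b k 1) k.
Proof.
rewrite -gcdn_modr -[RHS]gcdn_modr; congr (gcdn _ _).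
rewrite cE // -modn_summ.
under eq_bigr => i _.
  have -> : b ^ (i * k) = 1 %[mod c b k 1].
    apply/eqP; rewrite mulnC eqn_mod_dvd ?c1_dvd_sub1 // expn_gt0.
    by rewrite (ltnW b_gt1).
  over.
by rewrite modn_summ sum1_card card_ord.
Qed.

Lemma gcdn_c1_dvd_c n : 1 <= n -> gcdn (c b k 1) k %| c b k n.
Proof.
move=> n1; have E_gt0 : 0 < gcdn (c b k 1) k by rewrite gcdn_gt0 k_gt0 orbT.
apply/dvdn_partP => // p /[!mem_primes] /and3P[p_pr _ _].
have := dvdn_part p (gcdn (c b k 1) k); rewrite dvdn_gcd p_part.
move: (logn _ _) => e /andP[pe_c1 pe_k].
have [p_dvd|p_ndvd] := boolP (p %| b ^ n - 1).
  rewrite cE //; under eq_bigr => i _ do rewrite mulnC expnM.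
  apply: dvdn_pfactor_geometric_sum => //.
  by apply/eqP; rewrite eqn_mod_dvd // expn_gt0 (ltnW b_gt1).
rewrite -(@Gauss_dvdl _ _ (b ^ n - 1)) ?coprimeXl ?prime_coprime //.
by rewrite mul_c_sub1 // (dvdn_trans pe_c1) ?c1_dvd_sub1.
Qed.

Lemma common_divisor_kth_powers d :
  common_divisor (kth_powers b k) d <->
  common_divisor [set c b k n | n in [set n | 1 <= n]] d.
Proof.
split=> [dS _ [n n1 <-]|dc _ [->|[n [a [n1 _ ->]]]]]; last first.
- by rewrite dvdn_mull //; apply: dc; exists n.
- exact: dvdn0.
have dM a : b ^ (n - 1) <= a < b ^ n -> d %| a * c b k n.
  by move=> ab; apply: dS; right; exists n, a.
case: n n1 dM => // -[|n] _; rewrite subn1 /= => dM.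
  (* Blocks of length one are treated apart: for [b = 2] only [a = 1] is admissible, so no
     difference is available, but [a = 1] yields [c b k 1] itself. *)
  by rewrite -[c _ _ _]mul1n dM // expn0 expn1.
(* [b ^ n.+1] and its successor are both admissible values of [a], and the
   difference of the corresponding powers is [c b k n.+2]. *)
have bn_gt1 : 1 < b ^ n.+1 by rewrite -(expn0 b) ltn_exp2l.
have b2 : (b ^ n.+1).*2 <= b ^ n.+2.
  by rewrite -mul2n [b ^ n.+2]expnS leq_mul2r b_gt1 orbT.
have lt2 : (b ^ n.+1).+1 < b ^ n.+2.
  by apply: leq_trans b2; rewrite -addnn -addn2 leq_add2l.
rewrite -(@dvdn_addr (b ^ n.+1 * c b k n.+2)).
  by rewrite addnC -mulSn dM // leqnSn.
by rewrite dM // leqnn (ltnW lt2).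
Qed.

End KthPowers.

Theorem theorem1 (b k : nat) (hb : 2 <= b) (hk : 1 <= k) :
  let A := set_gcd (kth_powers b k) in
  let B := set_gcd [set c b k n | n in [set n | 1 <= n]] in
  let C := \big[gcdn/0]_(1 <= n < k.+1) c b k n in
  let D := gcdn (c b k 1) (c b k k) in
  let E := gcdn ((b ^ k - 1) %/ (b - 1)) k in
  [/\ A = B, B = C, C = D & D = E].
Proof.
move=> A B C D E.
have DE : D = E by rewrite /D /E -c1E gcdn_c1_ck.
have [dA maxA] := set_gcdP (kth_powers b k).
have [dB maxB] := set_gcdP [set c b k n | n in [set n | 1 <= n]].
have AB : A = B.
  apply/eqP; rewrite eqn_dvd; apply/andP; split.
    by apply/maxB/common_divisor_kth_powers.
  by apply/maxA/common_divisor_kth_powers.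
have BC : B %| C.
  rewrite /C big_nat_cond; elim/big_ind: _ => [|x y Bx By|n].
  - exact: dvdn0.
  - by rewrite dvdn_gcd Bx.
  - by rewrite andbT => /andP[n1 _]; apply: dB; exists n.
have Cc n : 1 <= n <= k -> C %| c b k n.
  (* Splitting the range at [n] makes [c b k n] the head of the second part. *)
  move=> /andP[n1 nk]; rewrite /C (@big_cat_nat _ _ _ n) //=; last exact: leqW.
  by rewrite [X in gcdn _ X]big_ltn // (dvdn_trans (dvdn_gcdr _ _)) // dvdn_gcdl.
have CD : C %| D by rewrite /D dvdn_gcd !Cc ?leqnn ?hk.
(* This closes the cycle of [B], [C], [D]: by [D = E], [D] divides every [c b k n]. *)
have DB : D %| B.
  apply: maxB => _ [n n1 <-].
  by rewrite DE /E -c1E gcdn_c1_dvd_c.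
split=> //; apply/eqP; rewrite eqn_dvd.
  by rewrite BC (dvdn_trans CD).
by rewrite CD (dvdn_trans DB).
Qed.
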